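(* Let $k\ge 1$. The cycle of gaps $\mathcal{G}(p_{k+1})$ is obtained from the cycle of gaps $\mathcal{G}(p_k)=(g_{k,1},\ldots,g_{k,\Phi_k})$ by the following three steps. (R1) The next prime is $p_{k+1}=g_{k,1}+1$. (R2) Concatenate $p_{k+1}$ copies of $\mathcal{G}(p_k)$, giving the sequence $g_{k,1},g_{k,2},\ldots,g_{k,p_{k+1}\Phi_k}$ (indices of $g_{k,\cdot}$ extended periodically with period $\Phi_k$). (R3) In this concatenated sequence, add together $g_{k,1}+g_{k,2}$ and record the index of this addition as $\tilde{i}_1=1$; then for $n=1,\ldots,\Phi_k-1$ successively, add together $g_{k,j}+g_{k,j+1}$ and set $\tilde{i}_{n+1}=j$, where $j$ is the index with $$\Gamma_{k,j}-\Gamma_{k,\tilde{i}_n}=p_{k+1}\cdot g_{k,n}.$$ The sequence resulting from performing all of these additions is $\mathcal{G}(p_{k+1})$.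
   Context: $p_i$ denotes the $i$-th prime ($p_1=2$), $\Pi_k=\prod_{i=1}^k p_i$, and $\Phi_k=\prod_{i=1}^k(p_i-1)$. The cycle of gaps $\mathcal{G}(p_k)=(g_{k,1},\ldots,g_{k,\Phi_k})$ is the sequence of differences between consecutive integers in $[1,\Pi_k+1]$ that are coprime to $\Pi_k$, listed in increasing order starting from $1$. (For example $\mathcal{G}(3)=(4,2)$ and $\mathcal{G}(5)=(6,4,2,4,2,4,6,2)$.) The indexing is extended periodically, $g_{k,j+\Phi_k}=g_{k,j}$, and $\Gamma_{k,j}=\sum_{i=1}^{j} g_{k,i}$, so the integers greater than $1$ coprime to $\Pi_k$ are exactly $1+\Gamma_{k,j}$, $j\ge 1$. ''Adding together $g_{k,j}+g_{k,j+1}$'' means replacing these two adjacent gaps by their sum, i.e. deleting the integer $1+\Gamma_{k,j}$ that separates them from the underlying list of integers. *)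

(* Defs.v *)
From mathcomp Require Import all_boot.

Set Implicit Arguments.
Unset Strict Implicit.
Unset Printing Implicit Defensive.

Lemma exists_prime_above (m : nat) : exists q, (m < q) && prime q.
Proof. by have [q ltmq prq] := prime_above m; exists q; rewrite ltmq prq. Qed.

Definition next_prime (m : nat) : nat := ex_minn (exists_prime_above m).

(* The i-th prime with nth_prime 1 = 2; nth_prime 0 = 0 only starts the
   recursion. *)
Definition nth_prime (i : nat) : nat := iter i next_prime 0.

Definition primorial (k : nat) : nat := \prod_(1 <= i < k.+1) nth_prime i.

Definition Phi (k : nat) : nat := \prod_(1 <= i < k.+1) (nth_prime i - 1).

Definition differences (s : seq nat) : seq nat :=
  if s is x :: s' then pairmap (fun a b => b - a) x s' else [::].

(* The range iota 1 N.+1 is 1, ..., N + 1. *)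
Definition gap_cycle (k : nat) : seq nat :=
  differences
    [seq m <- iota 1 (primorial k).+1 | coprime m (primorial k)].

(* g_{k,j}, for j >= 1, extended to all such j with period Phi k. *)
Definition gap (k j : nat) : nat := nth 0 (gap_cycle k) ((j - 1) %% Phi k).

Definition Gamma (k j : nat) : nat := \sum_(1 <= i < j.+1) gap k i.

(* gs is a list of gaps between consecutive integers starting from x0; the two
   adjacent gaps separated by the integer x are replaced by their sum. The list
   is unchanged if x does not separate two gaps of gs. *)
Fixpoint add_across (x x0 : nat) (gs : seq nat) : seq nat :=
  match gs with
  | a :: ((b :: gs'') as gs') =>
      if x0 + a == x then (a + b) :: gs'' else a :: add_across x (x0 + a) gs'
  | _ => gs
  end.

(* The indices in js refer to the original sequence g_{k,1}, g_{k,2}, ..., not to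
   positions in the current list: index j names the pair of gaps that are
   separated by the integer 1 + Gamma k j when the addition is performed. *)
Definition add_gaps (k : nat) (js gs : seq nat) : seq nat :=
  foldl (fun gs' j => add_across (1 + Gamma k j) 1 gs') gs js.

(* Main.v *)
(** Taking partial sums from 1 turns m concatenated copies of G(p_k) into the
    list of integers in [1, m * Pi_k + 1] coprime to Pi_k, and turns the addition
    of two adjacent gaps into the deletion of the integer separating them. With
    p = p_(k+1) copies, the integers to delete are the multiples of p in this
    list; since p is coprime to Pi_k, they are p * u_n, where
    u_n = 1 + Gamma_(k, n-1) is the n-th positive integer coprime to Pi_k. So
    the index i_n satisfies 1 + Gamma_(k, i_n) = p * u_n, and
    u_(n+1) - u_n = g_(k, n) gives the recurrence; p itself is u_2, the least
    integer > 1 coprime to Pi_k. *)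
Require Import Defs.
From mathcomp Require Import all_boot.

(** * Gap lists and their partial sums *)

Definition partial_sums (x : nat) (gs : seq nat) : seq nat :=
  x :: scanl addn x gs.

Lemma partial_sumsK x gs : differences (partial_sums x gs) = gs.
Proof. exact: (scanlK (f := fun a b => b - a) addKn). Qed.

(** Subtraction is truncated, so the differences can be summed back only along an increasing
    list. *)
Lemma differencesK x s :
  path ltn x s -> partial_sums x (differences (x :: s)) = x :: s.
Proof.
rewrite /partial_sums /= => xs; congr (_ :: _).
by elim: s x xs => //= y s IHs x /andP[/ltnW /subnKC -> /IHs ->].
Qed.

Lemma differences_gt0 x s : path ltn x s -> all (ltn 0) (differences (x :: s)).
Proof. by elim: s x => //= y s IHs x /andP[xy /IHs ->]; rewrite subn_gt0 xy. Qed.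

Lemma path_partial_sums x gs :
  all (ltn 0) gs -> path ltn x (scanl addn x gs).
Proof.
elim: gs x => //= a gs IHgs x /andP[a_gt0 /IHgs ->].
by rewrite andbT -[X in X < _]addn0 ltn_add2l.
Qed.

Lemma last_partial_sums x gs : last x (scanl addn x gs) = x + sumn gs.
Proof. by elim: gs x => [|a gs IHgs] x /=; rewrite ?addn0 // IHgs addnA. Qed.

Lemma scanl_addn_shift c x gs :
  scanl addn (c + x) gs = [seq c + y | y <- scanl addn x gs].
Proof. by elim: gs x => //= a gs IHgs x; rewrite -addnA IHgs. Qed.

Lemma all_gt0_add_across x x0 gs :
  all (ltn 0) gs -> all (ltn 0) (add_across x x0 gs).
Proof.
elim: gs x0 => // a [|b gs] //= IHgs x0 /andP[a_gt0 bgs].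
case: ifP => _ /=; last by rewrite a_gt0; apply: IHgs.
by case/andP: bgs => _ ->; rewrite addn_gt0 a_gt0.
Qed.

Lemma sumn_add_across x x0 gs : sumn (add_across x x0 gs) = sumn gs.
Proof.
elim: gs x0 => // a [|b gs] //= IHgs x0.
by case: ifP => _ /=; [rewrite addnA | rewrite IHgs].
Qed.

(* At the two end points the deletion fails: add_across leaves the list alone. *)
Lemma partial_sums_add_across x x0 gs :
    all (ltn 0) gs -> x != x0 -> x != x0 + sumn gs ->
  partial_sums x0 (add_across x x0 gs)
    = [seq y <- partial_sums x0 gs | y != x].
Proof.
elim: gs x0 => [|a [|b gs] IHgs] x0.
- by move=> _ xx0 _ /=; rewrite eq_sym xx0.
- by move=> _ xx0 /= xx1; rewrite addn0 in xx1; rewrite ![_ == x]eq_sym xx0 xx1.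
move=> abgs xx0 xend; have /andP[a_gt0 bgs] := abgs.
rewrite [add_across _ _ _]/= {2}/partial_sums [scanl _ _ _]/= [filter _ _]/=.
rewrite [x0 == x]eq_sym xx0 /=; case: eqVneq => [x0ax | xx1] /=; last first.
  have /= := IHgs (x0 + a) bgs; rewrite eq_sym xx1 -addnA => /(_ isT xend).
  by move=> IH; congr (_ :: _); apply: IH.
(* Here [x] is the first inner point; positive gaps put all later sums above [x], so the filter
   keeps them. *)
have /(order_path_min ltn_trans) /= := path_partial_sums (x0 + a) (b :: gs) bgs.
rewrite x0ax => /andP[xb gt_x].
rewrite /partial_sums /= addnA x0ax gtn_eqF //=; congr [:: _, _ & _].
by apply/esym/all_filterP; apply: sub_all gt_x => y /=; rewrite ltn_neqAle eq_sym => /andP[].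
Qed.

(** An addition keeps the gaps positive and the total unchanged, so the end points stay fixed and
    each later deletion still works by value. *)
Lemma partial_sums_foldl_add_across (f : nat -> nat) x0 js gs :
    all (ltn 0) gs ->
    {in js, forall j, f j != x0 /\ f j != x0 + sumn gs} ->
  partial_sums x0 (foldl (fun gs' j => add_across (f j) x0 gs') gs js)
    = [seq y <- partial_sums x0 gs | y \notin map f js].
Proof.
elim: js gs => [|j js IHjs] gs gs_gt0 inner; first by rewrite filter_predT.
have [fj0 fjend] := inner j (mem_head _ _).
rewrite [foldl _ _ _]/= IHjs ?all_gt0_add_across //; last first.
  by move=> i js_i; rewrite sumn_add_across; apply: inner; rewrite inE js_i orbT.
rewrite partial_sums_add_across // -filter_predI; apply: eq_filter => y /=.
by rewrite inE negb_or andbC.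
Qed.

(** * Primes, primorials and the totient *)

Lemma next_primeP m :
  [/\ prime (next_prime m), m < next_prime m
    & forall q, prime q -> m < q -> next_prime m <= q].
Proof.
rewrite /next_prime; case: ex_minnP => q /andP[mq q_pr] q_min.
by split=> // r r_pr mr; apply: q_min; rewrite mr.
Qed.

Lemma nth_primeS k : nth_prime k.+1 = next_prime (nth_prime k).
Proof. by []. Qed.

Lemma nth_prime_prime k : prime (nth_prime k.+1).
Proof. by case: (next_primeP (nth_prime k)). Qed.

Lemma primorialS k : primorial k.+1 = primorial k * nth_prime k.+1.
Proof. by rewrite /primorial big_nat_recr. Qed.

Lemma primorial_gt0 k : 0 < primorial k.
Proof.
elim: k => [|k IHk]; first by rewrite /primorial big_geq.
by rewrite primorialS muln_gt0 IHk prime_gt0 ?nth_prime_prime.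
Qed.

(** No prime lies strictly between [nth_prime k] and its successor; the induction starts at the
    empty product 1 and [nth_prime 0 = 0]. *)
Lemma prime_dvd_primorial q k :
  prime q -> (q %| primorial k) = (q <= nth_prime k).
Proof.
move=> q_pr; elim: k => [|k IHk].
  by rewrite /primorial big_geq // dvdn1 leqn0; case: q q_pr => [|[]].
rewrite primorialS Euclid_dvdM // IHk dvdn_prime2 ?nth_prime_prime //.
rewrite nth_primeS; have [_ lt_next next_min] := next_primeP (nth_prime k).
case: leqP => [qk | /next_min]; first by rewrite (leq_trans qk (ltnW lt_next)).
by rewrite eqn_leq => -> //; rewrite andbT.
Qed.

Lemma coprime_nth_primeS_primorial k : coprime (nth_prime k.+1) (primorial k).
Proof.
rewrite prime_coprime ?nth_prime_prime // prime_dvd_primorial ?nth_prime_prime //.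
by rewrite -ltnNge nth_primeS; case: (next_primeP (nth_prime k)).
Qed.

(** The least prime factor of [m] does not divide the primorial, so it exceeds [nth_prime k]. *)
Lemma nth_primeS_leq_coprime k m :
  1 < m -> coprime m (primorial k) -> nth_prime k.+1 <= m.
Proof.
move=> m_gt1 m_cop; have q_pr := pdiv_prime m_gt1.
have [_ _ next_min] := next_primeP (nth_prime k).
apply: leq_trans (pdiv_leq (ltnW m_gt1)); apply: next_min => //.
rewrite ltnNge -prime_dvd_primorial // -prime_coprime //.
exact: coprime_dvdl (pdiv_dvd m) m_cop.
Qed.

Lemma totient_primorial k : totient (primorial k) = Phi k.
Proof.
elim: k => [|k IHk]; first by rewrite /primorial /Phi !big_geq.
rewrite primorialS totient_coprime 1?coprime_sym ?coprime_nth_primeS_primorial //.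
by rewrite IHk totient_prime ?nth_prime_prime // -subn1 [RHS]/Phi big_nat_recr.
Qed.

Lemma Phi_gt0 k : 0 < Phi k.
Proof. by rewrite -totient_primorial totient_gt0 primorial_gt0. Qed.

(** * Lists of integers coprime to a modulus *)

Definition coprimes_upto (N P : nat) : seq nat :=
  [seq m <- iota 1 N | coprime m P].

Lemma coprimes_uptoS N P :
  coprimes_upto N.+1 P = 1 :: [seq m <- iota 2 N | coprime m P].
Proof. by rewrite /coprimes_upto /= coprime1n. Qed.

Lemma path_coprimes_upto N P : path ltn 1 [seq m <- iota 2 N | coprime m P].
Proof.
have := sorted_filter ltn_trans (fun m => coprime m P) (iota_ltn_sorted 1 N.+1).
by rewrite -/(coprimes_upto _ _) coprimes_uptoS.
Qed.

Lemma coprimes_upto_rcons P :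
  coprimes_upto P.+1 P = rcons (coprimes_upto P P) P.+1.
Proof.
rewrite /coprimes_upto -{1}[P.+1]addn1 iotaD filter_cat -cats1.
by rewrite /= add1n coprimeSn.
Qed.

Lemma size_coprimes_upto P :
  0 < P -> size (coprimes_upto P.+1 P) = (totient P).+1.
Proof.
case: P => // P _; rewrite coprimes_upto_rcons size_rcons size_filter; congr _.+1.
(* The totient counts over 0, ..., [P], the list over 1, ..., [P.+1]; the terms at 0 and at the
   modulus [P.+1] agree. *)
rewrite -sum1_count big_mkcond totient_count_coprime big_ltn //.
rewrite -[iota 1 P.+1]/(index_iota 1 P.+2) big_nat_recr //= addnC.
congr (_ + _); first by rewrite /coprime gcdnn gcdn0; case: P.
by apply: eq_bigr => d _; rewrite coprime_sym; case: coprime.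
Qed.

(** * The cycle of gaps, its copies and [Gamma] *)

Lemma gap_cycle_gt0 k : all (ltn 0) (gap_cycle k).
Proof.
rewrite /gap_cycle -/(coprimes_upto _ _) coprimes_uptoS.
exact/differences_gt0/path_coprimes_upto.
Qed.

Lemma partial_sums_gap_cycle k :
  partial_sums 1 (gap_cycle k) = coprimes_upto (primorial k).+1 (primorial k).
Proof.
rewrite /gap_cycle -/(coprimes_upto _ _) coprimes_uptoS.
exact/differencesK/path_coprimes_upto.
Qed.

Lemma size_gap_cycle k : size (gap_cycle k) = Phi k.
Proof.
apply: succn_inj; rewrite -totient_primorial -size_coprimes_upto ?primorial_gt0 //.
by rewrite -partial_sums_gap_cycle /= size_scanl.
Qed.

Lemma sumn_gap_cycle k : sumn (gap_cycle k) = primorial k.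
Proof.
have := congr1 (last 0) (partial_sums_gap_cycle k).
by rewrite coprimes_upto_rcons last_rcons /= last_partial_sums => -[].
Qed.

Lemma flatten_nseq_gap_cycle k m :
  flatten (nseq m (gap_cycle k)) = [seq gap k j | j <- iota 1 (m * Phi k)].
Proof.
elim: m => //= m IHm; rewrite IHm mulSn iotaD map_cat; congr (_ ++ _).
  apply: (@eq_from_nth _ 0) => [|i]; rewrite size_gap_cycle ?size_map ?size_iota //.
  move=> i_lt; rewrite (nth_map 0) ?size_iota // nth_iota //.
  by rewrite /gap addKn modn_small.
rewrite addnC iotaDl -map_comp; apply/eq_in_map => j.
rewrite mem_iota => /andP[j_gt0 _] /=.
(* [0 < j] lets the truncated [j - 1] commute with adding a period. *)
by rewrite /gap -addnBA // modnDl.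
Qed.

Lemma GammaS k j : Gamma k j.+1 = Gamma k j + gap k j.+1.
Proof. by rewrite /Gamma big_nat_recr. Qed.

Lemma Gamma0 k : Gamma k 0 = 0.
Proof. by rewrite /Gamma big_geq. Qed.

Lemma partial_sums_gaps k n :
  partial_sums 1 [seq gap k j | j <- iota 1 n]
    = [seq 1 + Gamma k j | j <- iota 0 n.+1].
Proof.
have scan_gaps j : scanl addn (1 + Gamma k j) [seq gap k i | i <- iota j.+1 n]
    = [seq 1 + Gamma k i | i <- iota j.+1 n].
  by elim: n j => // n IHn j; rewrite /= -addnA -GammaS IHn.
by have := scan_gaps 0; rewrite /partial_sums /= Gamma0 addn0 => ->.
Qed.

(** Coprimality to the primorial is periodic, and each copy starts at the last point of the previous
    one. *)
Lemma partial_sums_flatten_nseq k m :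
  partial_sums 1 (flatten (nseq m (gap_cycle k)))
    = coprimes_upto (m * primorial k).+1 (primorial k).
Proof.
elim: m => [|m IHm] /=; first by rewrite /coprimes_upto /= coprime1n.
rewrite /partial_sums scanl_cat -cat_cons -/(partial_sums 1 (gap_cycle k)).
rewrite partial_sums_gap_cycle mulSn -addSn /coprimes_upto iotaD filter_cat.
congr (_ ++ _).
have -> : foldl addn 1 (gap_cycle k) = primorial k + 1.
  by rewrite addnC -sumn_gap_cycle; elim: gap_cycle 1 => [|a s IHs] x /=;
    rewrite ?addn0 // IHs addnA.
(* The joint [primorial k + 1] already closes the first copy, so the shifted rest begins one later,
   matching the induction hypothesis without its head 1. *)
have -> : 1 + (primorial k).+1 = primorial k + 2 by rewrite addnC addSnnS.
move: IHm; rewrite scanl_addn_shift coprimes_uptoS => -[->].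
rewrite iotaDl filter_map; congr map; apply: eq_filter => i.
by rewrite /= /coprime [in RHS]gcdnC gcdnDl gcdnC.
Qed.

Lemma Gamma_coprimes k m :
  [seq 1 + Gamma k j | j <- iota 0 (m * Phi k).+1]
    = coprimes_upto (m * primorial k).+1 (primorial k).
Proof.
by rewrite -partial_sums_gaps -flatten_nseq_gap_cycle partial_sums_flatten_nseq.
Qed.

Lemma gap_gt0 k j : 0 < gap k j.
Proof.
apply: (allP (gap_cycle_gt0 k)).
by apply: mem_nth; rewrite size_gap_cycle ltn_mod Phi_gt0.
Qed.

Lemma leq_Gamma k : {mono Gamma k : i j / i <= j}.
Proof.
apply: leq_mono; apply: homo_ltn ltn_trans _ => j.
by rewrite GammaS -[X in X < _]addn0 ltn_add2l gap_gt0.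
Qed.

Lemma ltn_Gamma k : {mono Gamma k : i j / i < j}.
Proof. exact: leqW_mono (leq_Gamma k). Qed.

Lemma Gamma_inj k : injective (Gamma k).
Proof. exact: incn_inj (leq_Gamma k). Qed.

Lemma Gamma_mul_Phi k m : Gamma k (m * Phi k) = m * primorial k.
Proof.
have := last_partial_sums 1 [seq gap k j | j <- iota 1 (m * Phi k)].
have := congr1 (last 0) (partial_sums_gaps k (m * Phi k)).
rewrite -[(m * _).+1]addn1 iotaD map_cat last_cat add0n /= => ->.
rewrite -flatten_nseq_gap_cycle sumn_flatten map_nseq sumn_nseq sumn_gap_cycle.
by rewrite [_ * m]mulnC => /addnI.
Qed.

Lemma coprime_primorialP k m :
  reflect (exists j, m = 1 + Gamma k j) ((0 < m) && coprime m (primorial k)).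
Proof.
apply: (iffP idP) => [/andP[m_gt0 m_cop] | [j ->]].
  (* Any number of copies that reaches [m] would do; [m] copies always suffice. *)
  have: m \in coprimes_upto (m * primorial k).+1 (primorial k).
    by rewrite mem_filter m_cop mem_iota m_gt0 add1n ltnS leqW // leq_pmulr ?primorial_gt0.
  by rewrite -Gamma_coprimes => /mapP[j _ ->]; exists j.
have: 1 + Gamma k j \in [seq 1 + Gamma k j | j <- iota 0 (j * Phi k).+1].
  by apply/mapP; exists j; rewrite // mem_iota add0n ltnS leq_pmulr ?Phi_gt0.
by rewrite Gamma_coprimes mem_filter andbC => /andP[].
Qed.

Lemma nth_primeS_gap k : nth_prime k.+1 = gap k 1 + 1.
Proof.
have p_pr := nth_prime_prime k; have p_gt1 := prime_gt1 p_pr.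
have <- : 1 + Gamma k 1 = gap k 1 + 1 by rewrite GammaS Gamma0 addnC.
apply/eqP; rewrite eqn_leq; apply/andP; split.
  have /andP[_ cop1] : (0 < 1 + Gamma k 1) && coprime (1 + Gamma k 1) (primorial k).
    by apply/coprime_primorialP; exists 1.
  by apply: nth_primeS_leq_coprime cop1; rewrite GammaS Gamma0 add1n ltnS gap_gt0.
have /coprime_primorialP[j def_p] :
    (0 < nth_prime k.+1) && coprime (nth_prime k.+1) (primorial k).
  by rewrite prime_gt0 // coprime_nth_primeS_primorial.
case: j def_p p_gt1 => [|j] -> //; first by rewrite Gamma0.
by rewrite leq_add2l leq_Gamma.
Qed.

Theorem lemma3p1 (k : nat) (hk : 1 <= k) :
  [/\ nth_prime k.+1 = gap k 1 + 1,
      flatten (nseq (nth_prime k.+1) (gap_cycle k)) =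
        [seq gap k j | j <- iota 1 (nth_prime k.+1 * Phi k)]
    & exists i : nat -> nat,
        [/\ i 1 = 1,
            forall n, 1 <= n <= Phi k - 1 ->
              unique (fun j => Gamma k j =
                                 Gamma k (i n) + nth_prime k.+1 * gap k n)
                     (i n.+1),
            forall n, 1 <= n <= Phi k -> 1 <= i n < nth_prime k.+1 * Phi k
          & add_gaps k [seq i n | n <- iota 1 (Phi k)]
              (flatten (nseq (nth_prime k.+1) (gap_cycle k))) =
              gap_cycle k.+1]].
Proof.
split; [exact: nth_primeS_gap | exact: flatten_nseq_gap_cycle |].
have p_pr := nth_prime_prime k; have p_gt1 := prime_gt1 p_pr.
have p_gt0 := prime_gt0 p_pr.
have p_cop := coprime_nth_primeS_primorial k.
have defp : nth_prime k.+1 = 1 + Gamma k 1.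
  by rewrite GammaS Gamma0 addnC nth_primeS_gap.
have := primorialS k.
move: (nth_prime k.+1) p_pr p_gt1 p_gt0 p_cop defp.
move=> p p_pr p_gt1 p_gt0 p_cop defp defPp.
have GammaPhi : Gamma k (Phi k) = primorial k.
  by have := Gamma_mul_Phi k 1; rewrite !mul1n.
(* The indices are chosen by the closed form p * u_n, with u_n = [1 + Gamma k n.-1]; the recurrence
   is derived afterwards. *)
have ex_i n : exists j, 1 + Gamma k j == p * (1 + Gamma k n.-1).
  have [|j ->] := coprime_primorialP k (p * (1 + Gamma k n.-1)) _; last by exists j.
  rewrite muln_gt0 p_gt0 coprimeMl p_cop /=.
  suff /coprime_primorialP : exists j, 1 + Gamma k n.-1 = 1 + Gamma k j by [].
  by exists n.-1.
pose i n := xchoose (ex_i n).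
have iP n : 1 + Gamma k (i n) = p * (1 + Gamma k n.-1).
  exact/eqP/(xchooseP (ex_i n)).
(* These bounds express 1 < p * u_n < 1 + p * Pi_k: each deleted integer is an inner point. *)
have i_bounds n : 1 <= n <= Phi k -> 1 <= i n < p * Phi k.
  case: n => // n n_lt; apply/andP; split.
    rewrite -(ltn_Gamma k) Gamma0 -(ltn_add2l 1) addn0 iP.
    by rewrite (leq_trans p_gt1) // leq_pmulr.
  rewrite -(ltn_Gamma k) Gamma_mul_Phi -(ltn_add2l 1) iP.
  rewrite ltnS leq_mul2l -GammaPhi ltn_Gamma [n.+1.-1 < _]n_lt orbT //.
exists i; split=> //.
- by apply: (@Gamma_inj k); apply: (@addnI 1); rewrite iP Gamma0 addn0 muln1.
- case=> // n _; split=> [|j defj].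
    by apply: (@addnI 1); rewrite addnA !iP -mulnDr -addnA -GammaS.
  apply: (@Gamma_inj k); rewrite defj.
  by apply: (@addnI 1); rewrite addnA !iP -mulnDr -addnA -GammaS.
(* Both gap lists are differences of their partial sums, so it suffices to compare the integers that
   remain. *)
rewrite /add_gaps -[LHS](partial_sumsK 1) partial_sums_foldl_add_across.
- rewrite partial_sums_flatten_nseq -[RHS](partial_sumsK 1) partial_sums_gap_cycle.
  congr differences; rewrite defPp [_ * p]mulnC /coprimes_upto -filter_predI.
  apply: eq_in_filter => m; rewrite mem_iota => /andP[m_gt0 m_le] /=.
  rewrite coprimeMr [RHS]andbC [coprime m p]coprime_sym (prime_coprime m p_pr).
  case m_cop: (coprime m (primorial k)); last by rewrite !andbF.
  rewrite !andbT; congr (~~ _); apply/mapP/idP => [[j /mapP[n _ ->] ->]|].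
    by rewrite iP dvdn_mulr.
  (* Conversely, the cofactor [u] of a multiple of [p] in the list is itself coprime to the
     primorial, hence some u_(n+1); it remains to see that n < Phi_k. *)
  case/dvdnP=> u def_m; have u_gt0 : 0 < u by case: u def_m m_gt0 => [->|].
  have /coprime_primorialP[n def_u] : (0 < u) && coprime u (primorial k).
    by rewrite u_gt0; apply: coprime_dvdl m_cop; rewrite def_m dvdn_mulr.
  exists (i n.+1); last by rewrite iP def_m def_u mulnC.
  apply: map_f; rewrite mem_iota /= add1n ltnS -(ltn_Gamma k) GammaPhi.
  rewrite -(ltn_add2l 1) -def_u add1n ltnS leqNgt; apply/negP=> u_gt.
  (* If u > Pi_k, then m >= p * Pi_k + p >= p * Pi_k + 2, beyond the range. *)
  move: m_le; rewrite add1n ltnS leqNgt def_m => /negP[].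
  apply: leq_trans (leq_mul u_gt (leqnn p)).
  by rewrite mulSn mulnC -addn2 addnC leq_add2r.
- by rewrite flatten_nseq_gap_cycle all_map; apply/allP => j _; apply: gap_gt0.
move=> j /mapP[n]; rewrite mem_iota add1n ltnS => n_bd ->.
have /andP[i_gt0 i_lt] := i_bounds n n_bd.
rewrite sumn_flatten map_nseq sumn_nseq sumn_gap_cycle [_ * p]mulnC.
rewrite -Gamma_mul_Phi eqn_add2l -[X in _ != X]addn0 eqn_add2l.
by rewrite -(Gamma0 k) !(inj_eq (@Gamma_inj k)) -lt0n i_gt0 neq_ltn i_lt.
Qed.
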